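(* Let $(G,+)$ be a group (not necessarily commutative), let $I[1],\dots,I[N]$ ($N\ge 1$) be elements of $G$, and let $A$ be the array obtained from $I$ by the Southwest Tree build procedure described in the context. Then for every $1\le i\le N$, the procedure $\texttt{accumulate}(i)$ described in the context returns $$I[1]+I[2]+\cdots+I[i],$$ with operands combined in increasing order of index.
   Context: Southwest Tree index structure: let $h_r=\lfloor \log_2 N\rfloor+1$. Define a full binary tree whose nodes are labelled by indices as follows: the root has index $2^{h_r}-1$ and height $h_r$; a node with index $i$ and height $h>1$ has left child with index $i-2^{h-1}$ and right child with index $i-1$, both of height $h-1$; nodes of height $1$ are leaves. Every index in $\{1,\dots,2^{h_r}-1\}$ occurs as exactly one node. Indices greater than $N$ are ''phantom'' nodes storing no value. Build procedure: initially $A[j]=I[j]$ for $1\le j\le N$. The tree is traversed depth-first in post-order; when visiting a node of index $i\le N$ with height $h>1$, set $A[i] := A[i-2^{h-1}] + A[i-1] + A[i]$ (in this order); phantom nodes and leaves are unchanged. Accumulate procedure: $\texttt{accumulate}(i)=\mathrm{acc}(i,\,2^{h_r}-1,\,2^{h_r-1})$, where $\mathrm{acc}(i,c,\ell)$ is defined recursively: if $c=i$, return $A[c]$; otherwise let $c'=c-\ell$ if $i\le c-\ell$ and $c'=c-1$ otherwise, let $v=\mathrm{acc}(i,c',\ell/2)$, and return $A[c-\ell]+v$ if $i>c-\ell$, and $v$ otherwise. The operation $+$ may be non-commutative; all sums are taken in the stated order. *)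

(* Defs.v *)
From mathcomp Require Import all_boot.

Set Implicit Arguments.
Unset Strict Implicit.
Unset Printing Implicit Defensive.

Local Open Scope group_scope.

(* The possibly non-commutative operation, customarily written +, is the
   multiplicative operation of groupType. *)

(* A memory is 1-indexed; [None] is the content of a cell holding no value:
   index 0, and every index above N (in particular phantom nodes). *)
Definition memory (G : Type) := nat -> option G.

(* A sum involving an absent value is absent, so an illegal read is never
   silently replaced by a default element of the group. *)
Definition oplus (G : groupType) (u v : option G) : option G :=
  if u is Some x then if v is Some y then Some (x * y) else None else None.

(* Only I 1, ..., I N are loaded; the other values of I are irrelevant. *)
Definition load (G : Type) (N : nat) (I : nat -> G) : memory G :=
  fun j => if (1 <= j <= N)%N then Some (I j) else None.

Definition write (G : Type) (A : memory G) (i : nat) (v : option G) : memory G :=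
  fun j => if j == i then v else A j.

(* Every node is labelled by its index and its height. *)
Inductive swtree : Type :=
| Leaf of nat & nat
| Node of nat & nat & swtree & swtree.

(* The subtree whose root has index i and height h. Only h >= 1 occurs; the
   value at h = 0 is a dummy. *)
Fixpoint southwest (i h : nat) : swtree :=
  if h is h'.+1 then
    if (1 < h)%N then
      Node i h (southwest (i - 2 ^ (h - 1))%N h') (southwest (i - 1)%N h')
    else Leaf i h
  else Leaf i h.

Definition root_height (N : nat) : nat := (trunc_log 2 N + 1)%N.

Definition root_index (N : nat) : nat := (2 ^ root_height N - 1)%N.

Definition southwest_tree (N : nat) : swtree :=
  southwest (root_index N) (root_height N).

Fixpoint postorder (t : swtree) : seq (nat * nat) :=
  match t with
  | Leaf i h => [:: (i, h)]
  | Node i h l r => postorder l ++ postorder r ++ [:: (i, h)]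
  end.

Definition visit (G : groupType) (N : nat) (A : memory G) (node : nat * nat) :
    memory G :=
  let: (i, h) := node in
  if (i <= N)%N && (1 < h)%N then
    write A i (oplus (oplus (A (i - 2 ^ (h - 1))%N) (A (i - 1)%N)) (A i))
  else A.

Definition build (G : groupType) (N : nat) (I : nat -> G) : memory G :=
  foldl (visit N) (load N I) (postorder (southwest_tree N)).

(* [fuel] only serves to make the recursion structural: running out of it yields
   [None], so a result [Some v] means that the procedure terminates and
   returns v. *)
Fixpoint acc (G : groupType) (fuel : nat) (A : memory G) (i c l : nat) :
    option G :=
  if fuel is fuel'.+1 then
    if c == i then A c
    else
      let c' := if (i <= c - l)%N then (c - l)%N else (c - 1)%N in
      let v := acc fuel' A i c' (l %/ 2) in
      if (c - l < i)%N then oplus (A (c - l)%N) v else v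
  else None.

(* The fuel is the number of levels of the tree. *)
Definition accum (G : groupType) (N : nat) (A : memory G) (i : nat) :
    option G :=
  acc (root_height N) A i (root_index N) (2 ^ (root_height N - 1)).

(* Main.v *)
(** The subtree whose root has index c and height h carries exactly the indices
    b + 1, ..., c, where c = b + 2 ^ h - 1; its left subtree has the same b, its
    right subtree starts where the left one stops, and its root comes last.
    Hence post-order building stores in every non-phantom root c the product of
    I over b + 1, ..., c, and the descent towards i multiplies the full products
    of the left subtrees that it skips, from left to right. *)
Require Import Defs.
From mathcomp Require Import all_boot zify.

Local Open Scope nat_scope.

(** A subtree is addressed by the offset [b] just before its indices. A phantom root is
    unconstrained, but the recursion continues below it, where non-phantom nodes may occur. *)
Fixpoint built (G : groupType) (N : nat) (I : nat -> G) (A : memory G)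
    (b h : nat) : Prop :=
  if h is h'.+1 then
    [/\ b + 2 ^ h - 1 <= N ->
          A (b + 2 ^ h - 1) = Some (\prod_(b.+1 <= j < b + 2 ^ h) I j)%g,
        built G N I A b h' & built G N I A (b + 2 ^ h' - 1) h']
  else True.

Arguments built {G} N I A b h.

Section Southwest.

Variables (G : groupType) (N : nat) (I : nat -> G).

(** Frame property: it carries the left subtree through the building of the right one, and both
    through the write at their parent. *)
Lemma eq_built (A A' : memory G) (b h : nat) :
  (forall j, b < j < b + 2 ^ h -> A' j = A j) ->
  built N I A b h -> built N I A' b h.
Proof.
elim: h b => [//|h IHh] b eqA [Ac Al Ar].
have gt0 : 0 < 2 ^ h by rewrite expn_gt0.
have eS : 2 ^ h.+1 = 2 * 2 ^ h by rewrite expnS.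
split.
- by move=> le_cN; rewrite eqA ?Ac //; lia.
- by apply: IHh Al => j hj; apply: eqA; lia.
- by apply: IHh Ar => j hj; apply: eqA; lia.
Qed.

Lemma built_root (A : memory G) (b h : nat) :
  0 < h -> b + 2 ^ h - 1 <= N -> built N I A b h ->
  A (b + 2 ^ h - 1) = Some (\prod_(b.+1 <= j < b + 2 ^ h) I j)%g.
Proof. by case: h => // h _ le_cN [/(_ le_cN)]. Qed.

(** The first conjunct strengthens the induction: after the left subtree is built, the cells of the
    right one and of the root are still as loaded. *)
Lemma postorder_built (h b : nat) (A : memory G) :
  0 < h -> (forall j, b < j < b + 2 ^ h -> A j = load N I j) ->
  let A' := foldl (visit N) A (postorder (southwest (b + 2 ^ h - 1) h)) in
  (forall j, ~~ (b < j < b + 2 ^ h) -> A' j = A j) /\ built N I A' b h.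
Proof.
elim: h b A => [//|h IHh] b A _ loadA.
have gt0 : 0 < 2 ^ h by rewrite expn_gt0.
have eS : 2 ^ h.+1 = 2 * 2 ^ h by rewrite expnS.
have [h0|h_gt0] := posnP h.
  subst h; rewrite /= andbF; split=> //; split=> // le_cN.
  have -> : b + 2 ^ 1 - 1 = b.+1 by lia.
  have -> : b + 2 ^ 1 = b.+2 by lia.
  rewrite big_nat1 loadA /load; last by lia.
  by have -> : 1 <= b.+1 <= N by lia.
have -> : southwest (b + 2 ^ h.+1 - 1) h.+1 =
    Node (b + 2 ^ h.+1 - 1) h.+1 (southwest (b + 2 ^ h - 1) h)
         (southwest (b + 2 ^ h - 1 + 2 ^ h - 1) h).
  rewrite [LHS]/= ltnS h_gt0 [h.+1 - 1]subn1 [h.+1.-1]/=.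
  by congr (Node _ _ (southwest _ _) (southwest _ _)); lia.
cbv zeta; rewrite /postorder -/postorder !foldl_cat.
have [|outL builtL] := IHh b A h_gt0 => [j hj|]; first by apply: loadA; lia.
set AL := foldl _ A _ in outL builtL *.
have [|outR builtR] := IHh (b + 2 ^ h - 1) AL h_gt0 => [j hj|].
  by rewrite outL ?loadA //; lia.
set AR := foldl _ AL _ in outR builtR *.
have {}builtL : built N I AR b h by apply: eq_built builtL => j hj; apply: outR; lia.
rewrite /= ltnS h_gt0 andbT.
case: leqP => [le_cN|lt_Nc]; last first.
  (* Phantom root: the visit writes nothing and the root clause of [built] is vacuous. *)
  split=> [j hj|]; first by rewrite outR ?outL //; lia.
  by split=> //; lia.
split=> [j hj|].
  by rewrite /write; case: eqP => [|_]; [lia | rewrite outR ?outL //; lia].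
split=> [_||].
- rewrite /write eqxx [h.+1 - 1]subn1 [h.+1.-1]/=.
  have -> : b + 2 ^ h.+1 - 1 - 2 ^ h = b + 2 ^ h - 1 by lia.
  have -> : b + 2 ^ h.+1 - 1 - 1 = b + 2 ^ h - 1 + 2 ^ h - 1 by lia.
  rewrite (built_root _ _ _ _ _ builtL) //; last by lia.
  rewrite (built_root _ _ _ _ _ builtR) //; last by lia.
  rewrite outR; last by lia.
  rewrite outL; last by lia.
  rewrite loadA; last by lia.
  rewrite /load ifT /=; last by lia.
  congr Some.
  have -> : (b + 2 ^ h - 1).+1 = b + 2 ^ h by lia.
  have -> : b + 2 ^ h - 1 + 2 ^ h = b + 2 ^ h.+1 - 1 by lia.
  rewrite -(@big_cat_nat _ _ _ (b + 2 ^ h)) /=; [|lia..].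
  rewrite -big_nat_recr /=; last by lia.
  by have -> : (b + 2 ^ h.+1 - 1).+1 = b + 2 ^ h.+1 by lia.
- by apply: eq_built builtL => j hj; rewrite /write; case: eqP => //; lia.
- by apply: eq_built builtR => j hj; rewrite /write; case: eqP => //; lia.
Qed.

(** Fuel equal to the height suffices, since each call descends one level. *)
Lemma acc_built (A : memory G) (i h b : nat) :
  built N I A b h -> b < i < b + 2 ^ h -> i <= N ->
  acc h A i (b + 2 ^ h - 1) (2 ^ (h - 1)) =
    Some (\prod_(b.+1 <= j < i.+1) I j)%g.
Proof.
elim: h b => [|h IHh] b; first by lia.
move=> builtA hi le_iN; have [Ac Al Ar] := builtA.
have gt0 : 0 < 2 ^ h by rewrite expn_gt0.
have eS : 2 ^ h.+1 = 2 * 2 ^ h by rewrite expnS.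
rewrite /=; case: eqP => [ci|neq_ci].
  rewrite Ac; last by lia.
  by have -> : b + 2 ^ h.+1 = i.+1 by lia.
(* At height 1 the root is the only index in range, so [neq_ci] excludes it. *)
have h_gt0 : 0 < h by case: h neq_ci hi {IHh builtA Ac Al Ar eS gt0} => //=; lia.
have -> : 2 ^ (h.+1 - 1) = 2 ^ h by rewrite subn1.
have -> : 2 ^ h %/ 2 = 2 ^ (h - 1).
  by rewrite -{1}(subnK h_gt0) addn1 expnS mulKn.
have -> : b + 2 ^ h.+1 - 1 - 2 ^ h = b + 2 ^ h - 1 by lia.
case: leqP => [le_i|gt_i]; first by apply: IHh => //; lia.
have -> : b + 2 ^ h.+1 - 1 - 1 = b + 2 ^ h - 1 + 2 ^ h - 1 by lia.
rewrite IHh //; last by lia.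
(* The left root lies below [i <= N], so it is not phantom and stores its full product. *)
rewrite (built_root _ _ _ _ _ Al) //=; last by lia.
have -> : (b + 2 ^ h - 1).+1 = b + 2 ^ h by lia.
by rewrite -big_cat_nat //=; lia.
Qed.

End Southwest.

Local Open Scope group_scope.

Theorem theorem1 (G : groupType) (N : nat) (hN : (1 <= N)%N) (I : nat -> G)
    (i : nat) (hi : (1 <= i <= N)%N) :
  accum N (build N I) i = Some (\prod_(1 <= j < i.+1) I j).
Proof.
have h_gt0 : (0 < root_height N)%N by rewrite /root_height addn1.
have lt_N : (N < 2 ^ root_height N)%N.
  by rewrite /root_height addn1 trunc_log_ltn.
have [//|_ builtA] := postorder_built G N I _ 0 (load N I) h_gt0.
by apply: acc_built builtA _ _; lia.
Qed.
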